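(* Let $\lambda$ be a partition and $q$ a positive integer. Then $(\mathrm{Inc}^q(\lambda),\langle K\text{-}\mathrm{Pro}\rangle,\mathrm{Con})$ exhibits resonance with frequency $q$.
   Context: **Resonance.** Let $G=\langle g\rangle$ be a cyclic group acting on a set $X$, $\mathcal C_\omega=\langle c\rangle$ a cyclic group of order $\omega$ acting nontrivially on a set $Y$, and $f:X\to Y$ a surjection. The triple $(X,G,f)$ exhibits resonance with frequency $\omega$ if $c\cdot f(x)=f(g\cdot x)$ for all $x\in X$. **Increasing tableaux.** A partition $\lambda$ is identified with its Young diagram (English convention). An increasing tableau of shape $\lambda$ is a filling of the boxes of $\lambda$ with positive integers that strictly increase from left to right along rows and from top to bottom down columns. $\mathrm{Inc}^q(\lambda)$ is the set of increasing tableaux of shape $\lambda$ with all entries at most $q$ (not every integer in $\{1,\dots,q\}$ need appear). The binary content of $T\in\mathrm{Inc}^q(\lambda)$ is $\mathrm{Con}(T)=(a_1,\dots,a_q)$, where $a_i=1$ if $i$ is an entry of $T$ and $a_i=0$ otherwise. In the resonance statement, $\mathrm{Con}$ is regarded as a map onto the set of binary contents of tableaux in $\mathrm{Inc}^q(\lambda)$, and the generator $c$ of the cyclic group of order $q$ acts by the cyclic shift $(a_1,a_2,\dots,a_q)\mapsto(a_2,\dots,a_q,a_1)$. **$K$-promotion.** For $T\in\mathrm{Inc}^q(\lambda)$, delete all labels $1$. Then for $i=2,3,\dots,q$ in turn, consider the set of boxes that are currently empty or contain $i$, and decompose it into connected components (adjacency = sharing an edge; these components are short ribbons, i.e. contain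 no $2\times2$ square and have at most two boxes in each row and column). In each component with more than one box, simultaneously delete every label $i$ and place $i$ in every box that was empty; leave one-box components unchanged. After this, all empty boxes are at outer corners of $\lambda$; fill them with $q+1$ and then subtract $1$ from every entry. The result is $K\text{-}\mathrm{Pro}(T)\in\mathrm{Inc}^q(\lambda)$. $K\text{-}\mathrm{Pro}$ is a bijection of $\mathrm{Inc}^q(\lambda)$.
   Formalization: Nontriviality of the cyclic action fails when λ is empty or q is at most the longest chain of boxes in λ (at most one binary content then); the other clauses of resonance are proved for all λ and q, and full resonance exactly when λ is nonempty and its longest chain has fewer than q boxes. *)

(* Defs.v *)
From HB Require Import structures.
From mathcomp Require Import all_boot all_fingroup.
From mathcomp Require Import zify.

Set Implicit Arguments.
Unset Strict Implicit.
Unset Printing Implicit Defensive.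

Local Open Scope nat_scope.

(** ** Resonance *)

(* [to] and [to'] are library (total) actions of the ambient groups [gT], [cT];
   only their restrictions to [G] and [C] matter.  [Y] is a set inside an
   ambient type [W], so that [f] is a surjection onto [Y] when its image is [Y],
   and [C] acts on [Y] when [Y] is stable under [C]. *)
Definition resonance_equivariance (gT cT : finGroupType) (X W : finType)
    (G : {group gT}) (g : gT) (to : {action gT &-> X})
    (C : {group cT}) (c : cT) (to' : {action cT &-> W})
    (Y : {set W}) (f : X -> W) (omega : nat) : Prop :=
  [/\ G :=: <[g]>%g, C :=: <[c]>%g & #|C| = omega] /\
  [/\ [acts C, on Y | to'],
      [set f x | x : X] = Y
    & forall x : X, to' (f x) c = f (to x g)].

Definition acts_nontrivially (cT : finGroupType) (W : finType)
    (C : {group cT}) (to' : {action cT &-> W}) (Y : {set W}) : Prop :=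
  exists2 a, a \in C & exists2 y, y \in Y & to' y a != y.

Definition exhibits_resonance (gT cT : finGroupType) (X W : finType)
    (G : {group gT}) (g : gT) (to : {action gT &-> X})
    (C : {group cT}) (c : cT) (to' : {action cT &-> W})
    (Y : {set W}) (f : X -> W) (omega : nat) : Prop :=
  acts_nontrivially C to' Y /\
  resonance_equivariance G g to C c to' Y f omega.

(** ** Partitions and increasing tableaux *)

Record int_partition := IntPartition {
  parts :> seq nat;
  parts_wf : sorted geq parts && (0 \notin parts) }.

(* Boxes in matrix coordinates (row, column), both counted from 0. *)
Definition box (la : int_partition) : finType :=
  {x : 'I_(size la) * 'I_(head 0 la) | x.2 < nth 0 la x.1}.

Definition row (la : int_partition) (b : box la) : nat := (val b).1.
Definition col (la : int_partition) (b : box la) : nat := (val b).2.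

Definition increasing (la : int_partition) (t : box la -> nat) : bool :=
  [forall b, forall b',
     (((row b == row b') && (col b < col b')) ==> (t b < t b')) &&
     (((col b == col b') && (row b < row b')) ==> (t b < t b'))].

Definition is_inc (la : int_partition) (q : nat) (t : {ffun box la -> 'I_q.+1}) :=
  [forall b, 0 < t b] && @increasing la (fun b => t b).

Definition Inc (q : nat) (la : int_partition) : finType :=
  {t : {ffun box la -> 'I_q.+1} | is_inc t}.

Definition entry (q : nat) (la : int_partition) (T : Inc q la) (b : box la) : nat :=
  val T b.

(* [Con T] at position [i : 'I_q] is a_(i+1). *)
Definition Con (q : nat) (la : int_partition) (T : Inc q la) : q.-tuple bool :=
  [tuple [exists b, entry T b == i.+1] | i < q].

Definition contents (q : nat) (la : int_partition) : {set q.-tuple bool} :=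
  [set Con T | T : Inc q la].

Lemma cyc_shift_inj (q : nat) :
  injective (fun a : q.-tuple bool => [tuple of rot 1 a]).
Proof. by move=> a b /(congr1 val) /= /rot_inj /val_inj. Qed.

(* (a_1, a_2, .., a_q) |-> (a_2, .., a_q, a_1) on all binary words; the group
   it generates is cyclic of order q for every q > 0. *)
Definition cyc_shift (q : nat) : {perm q.-tuple bool} := perm (@cyc_shift_inj q).

(* The number of boxes in a longest chain of boxes, each one directly to the
   right of or directly below the previous one.  Inc^q(la) is empty when this
   exceeds q, every tableau uses all of 1, .., q when it equals q, and no label
   is used when it is 0; in these cases no cyclic action on the contents is
   nontrivial, the set of contents having at most one element. *)
Definition chain_length (la : int_partition) : nat :=
  \max_(r < size la) (r + nth 0 la r).

(** ** K-promotion *)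

Definition adjacent (la : int_partition) : rel (box la) := fun b b' =>
  ((row b == row b') &&
     (((col b).+1 == col b') || ((col b').+1 == col b))) ||
  ((col b == col b') &&
     (((row b).+1 == row b') || ((row b').+1 == row b))).

(* For [b] in [A]: the connected component of [b] in [A]. *)
Definition component (la : int_partition) (A : pred (box la)) (b : box la) :
    {set box la} :=
  [set b' | connect [rel x y | [&& A x, A y & adjacent x y]] b b'].

(* Partially emptied fillings; [None] is an empty box. *)
Definition delete1 (la : int_partition) (t : box la -> nat) : box la -> option nat :=
  fun b => if t b == 1 then None else Some (t b).

Definition active (la : int_partition) (i : nat) (s : box la -> option nat) :
    pred (box la) :=
  fun b => (s b == None) || (s b == Some i).

Definition slide (la : int_partition) (s : box la -> option nat) (i : nat) :
    box la -> option nat :=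
  fun b => if active i s b && (1 < #|component (active i s) b|)
           then (if s b is None then Some i else None)
           else s b.

Definition KPro_fill (la : int_partition) (q : nat) (t : box la -> nat) :
    box la -> nat :=
  fun b => (odflt q.+1 (foldl (@slide la) (delete1 t) (iota 2 q.-1) b)).-1.

(* K-Pro preserves Inc^q(la) and is injective: reading an empty box as i after
   step i, and lowering the labels 1, .., i by one, step i.+1 exchanges the
   values i and i.+1 on the one-box components and does nothing elsewhere. *)

Definition swap (la : int_partition) (k : nat) (v : box la -> nat) : box la -> nat :=
  let A b := (v b == k) || (v b == k.+1) in
  fun b => if A b && ~~ (1 < #|component A b|)
           then (if v b == k then k.+1 else k) else v b.

Definition reading (la : int_partition) (i : nat) (s : box la -> option nat) :
    box la -> nat :=
  fun b => if s b is Some j then (if j <= i then j.-1 else j) else i.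

Lemma eq_component (la : int_partition) (A B : pred (box la)) :
  A =1 B -> component A =1 component B.
Proof.
move=> eqAB b; apply/setP => b'; rewrite !inE.
by apply: eq_connect => x y /=; rewrite !eqAB.
Qed.

Lemma eq_swap (la : int_partition) k (v w : box la -> nat) :
  v =1 w -> swap k v =1 swap k w.
Proof.
move=> eqvw b; rewrite /swap eqvw.
rewrite (@eq_component _ _ (fun b => (w b == k) || (w b == k.+1))) //.
by move=> x; rewrite eqvw.
Qed.

Lemma swapK (la : int_partition) k (v : box la -> nat) : swap k (swap k v) =1 v.
Proof.
have act x : ((swap k v x == k) || (swap k v x == k.+1)) =
             ((v x == k) || (v x == k.+1)).
  by rewrite /swap; case: ifP => // /andP[-> _]; case: ifP; rewrite eqxx ?orbT.
move=> b; rewrite {1}/swap act (eq_component act).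
rewrite /swap; set A := (_ || _); set c := (1 < _).
case: (boolP A) => //= HA; case: c => //=.
move: HA; rewrite /A; case: (v b =P k) => [->|_] /= => [_|/eqP ->].
  by case: eqP => //; lia.
by rewrite eqxx.
Qed.

Lemma reading_slide (la : int_partition) k (s : box la -> option nat) : 0 < k ->
  reading k.+1 (slide s k.+1) =1 swap k (reading k s).
Proof.
move=> k_gt0.
have act x : active k.+1 s x = (reading k s x == k) || (reading k s x == k.+1).
  rewrite /active /reading; case: (s x) => [j|] /=; last by rewrite eqxx.
  rewrite (inj_eq Some_inj); case: leqP; lia.
move=> b; rewrite /reading /slide /swap.
rewrite -/(reading k s) -(eq_component act) act.
rewrite /reading; case: (s b) => [j|] /=; last first.
  by rewrite eqxx /=; case: ifP => //= _; rewrite ltnSn.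
case: (1 < _); rewrite ?andbT ?andbF /=;
  case: (leqP j k) => /= Hj; do ![case: ifP => ? /=]; lia.
Qed.

Lemma reading_slides (la : int_partition) (t : box la -> nat) n :
  reading n.+1 (foldl (@slide la) (delete1 t) (iota 2 n)) =1
  foldl (fun v k => swap k v) t (iota 1 n).
Proof.
elim: n => [|n IHn] b.
  rewrite /= /reading /delete1; case: eqP => [->//|/=]; case: ifP; lia.
have iotaSr m : iota m n.+1 = rcons (iota m n) (m + n).
  by rewrite -addn1 iotaD cats1.
rewrite !iotaSr !foldl_rcons add1n add2n reading_slide //.
exact: eq_swap.
Qed.

Lemma swap_inj (la : int_partition) k (v w : box la -> nat) :
  swap k v =1 swap k w -> v =1 w.
Proof. by move=> e b; rewrite -[v b](swapK k) -[w b](swapK k); apply: eq_swap. Qed.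

Lemma swaps_inj (la : int_partition) ks (v w : box la -> nat) :
  foldl (fun v k => swap k v) v ks =1 foldl (fun v k => swap k v) w ks ->
  v =1 w.
Proof. by elim: ks v w => //= k ks IH v w /IH /swap_inj. Qed.

Lemma swap_bound (la : int_partition) q k (v : box la -> nat) : 0 < k < q ->
  (forall b, 0 < v b <= q) -> forall b, 0 < swap k v b <= q.
Proof.
by move=> Hk Hv b; rewrite /swap; have := Hv b; case: ifP => // _; case: ifP; lia.
Qed.

Lemma component_gt1 (la : int_partition) (A : pred (box la)) b b' :
  A b -> A b' -> adjacent b b' -> b != b' ->
  (1 < #|component A b|) && (1 < #|component A b'|).
Proof.
have main x y : A x -> A y -> adjacent x y -> x != y -> 1 < #|component A x|.
  move=> Ax Ay xy nxy; apply/card_gt1P; exists x, y; split=> //.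
    by rewrite inE connect0.
  by rewrite inE; apply: connect1; rewrite /= Ax Ay.
move=> Ab Ab' bb' nbb'; rewrite (main b b') ?(main b' b) // 1?eq_sym //.
by move: bb'; rewrite /adjacent; lia.
Qed.

Lemma parts_leq (la : int_partition) r r' : r <= r' -> nth 0 la r' <= nth 0 la r.
Proof.
case: la => s /= /andP[s_sorted _] rr'.
have [|Hr'] := ltnP r' (size s); last by rewrite nth_default.
move=> Hr'; have geq_trans : transitive geq.
  by move=> x y z /= xy yz; apply: leq_trans yz xy.
apply: (sorted_leq_nth geq_trans leqnn 0 s_sorted) => //.
by rewrite inE; apply: leq_ltn_trans Hr'.
Qed.

Lemma box_in (la : int_partition) (b : box la) : col b < nth 0 la (row b).
Proof. exact: (valP b). Qed.

Lemma box_ex (la : int_partition) r c : c < nth 0 la r ->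
  exists b : box la, row b = r /\ col b = c.
Proof.
move=> Hc.
have Hr : r < size la by rewrite ltnNge; apply/negP => /(nth_default 0) E; lia.
have Hh : c < head 0 la by rewrite -nth0; apply: leq_trans Hc (parts_leq _ _).
have H : (Ordinal Hr, Ordinal Hh).2 < nth 0 la (Ordinal Hr, Ordinal Hh).1 by [].
by exists (Sub (Ordinal Hr, Ordinal Hh) H); rewrite /row /col SubK.
Qed.

Lemma increasingP (la : int_partition) (t : box la -> nat) :
  reflect (forall b b',
     (row b = row b' /\ col b < col b') \/ (col b = col b' /\ row b < row b') ->
     t b < t b')
   (increasing t).
Proof.
apply: (iffP idP) => [H b b'|H].
  move/forallP: H => /(_ b) /forallP /(_ b') /andP[/implyP h1 /implyP h2].
  by case=> [[e l]|[e l]]; [apply: h1|apply: h2]; rewrite e eqxx.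
apply/forallP => b; apply/forallP => b'; apply/andP; split; apply/implyP.
  by move=> /andP[/eqP e l]; apply: H; left.
by move=> /andP[/eqP e l]; apply: H; right.
Qed.

Lemma swap_increasing (la : int_partition) k (v : box la -> nat) :
  increasing v -> increasing (swap k v).
Proof.
move/increasingP => vP; apply/increasingP => b b' bb'.
have vbb' := vP _ _ bb'.
have [/andP[/eqP vb /eqP vb']|N] :=
    boolP ((v b == k) && (v b' == k.+1)); last first.
  rewrite /swap; do ![case: ifP => ?]; lia.
have adj : adjacent b b'.
  rewrite /adjacent; case: bb' => [[er lc]|[ec lr]].
    have [e|Hc] := eqVneq (col b).+1 (col b'); first by lia.
    have [|x [xr xc]] := @box_ex la (row b) (col b).+1.
      by have := box_in b'; rewrite er; lia.
    have := vP b x; have := vP x b'; rewrite xr xc; lia.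
  have [e|Hr] := eqVneq (row b).+1 (row b'); first by lia.
  have [|x [xr xc]] := @box_ex la (row b).+1 (col b).
    rewrite ec; apply: leq_trans (box_in b') _; exact: parts_leq.
  have := vP b x; have := vP x b'; rewrite xr xc; lia.
have nbb' : b != b' by apply/eqP => e; move: vbb'; rewrite e ltnn.
pose A x := (v x == k) || (v x == k.+1).
have /andP[c1 c2] : (1 < #|component A b|) && (1 < #|component A b'|).
  by apply: component_gt1 => //; rewrite /A ?vb ?vb' eqxx ?orbT.
by rewrite /swap -/A c1 c2 !andbF.
Qed.

Lemma swaps_inc (la : int_partition) q (v : box la -> nat) ks :
  all (fun k => 0 < k < q) ks ->
  (forall b, 0 < v b <= q) -> increasing v ->
  (forall b, 0 < foldl (fun v k => swap k v) v ks b <= q) /\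
  increasing (foldl (fun v k => swap k v) v ks).
Proof.
elim: ks v => [|k ks IH] v //= /andP[Hk Hks] vb vi.
by apply: IH => //; [apply: swap_bound | apply: swap_increasing].
Qed.

Section KPro.

Context (q : nat) (la : int_partition).

Implicit Type T : Inc q la.

Lemma entry_bound T b : 0 < entry T b <= q.
Proof.
have /andP[/forallP/(_ b) h _] := valP T.
by rewrite /entry h -ltnS ltn_ord.
Qed.

Lemma entry_increasing T : increasing (entry T).
Proof. by have /andP[] := valP T. Qed.

Lemma swaps_entry T :
  (forall b, 0 < foldl (fun v k => swap k v) (entry T) (iota 1 q.-1) b <= q) /\
  increasing (foldl (fun v k => swap k v) (entry T) (iota 1 q.-1)).
Proof.
apply: swaps_inc; [|exact: entry_bound|exact: entry_increasing].
by apply/allP => k; rewrite mem_iota; lia.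
Qed.

Lemma KPro_fillE T :
  KPro_fill q (entry T) =1
  foldl (fun v k => swap k v) (entry T) (iota 1 q.-1).
Proof.
move=> b; have [/(_ b) Hb _] := swaps_entry T.
have q_gt0 : 0 < q by lia.
move: Hb; rewrite -reading_slides prednK // /KPro_fill /reading.
by case: foldl => [j|] //=; case: (leqP j q) => /=; lia.
Qed.

Lemma KPro_fill_bound T b : 0 < KPro_fill q (entry T) b <= q.
Proof. by rewrite KPro_fillE; case: (swaps_entry T). Qed.

Definition KPro_ffun T : {ffun box la -> 'I_q.+1} :=
  [ffun b => inord (KPro_fill q (entry T) b)].

Lemma KPro_ffunE T b : KPro_ffun T b = KPro_fill q (entry T) b :> nat.
Proof. by rewrite ffunE inordK // ltnS; case/andP: (KPro_fill_bound T b). Qed.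

Lemma KPro_is_inc T : is_inc (KPro_ffun T).
Proof.
apply/andP; split.
  by apply/forallP => b; rewrite KPro_ffunE; case/andP: (KPro_fill_bound T b).
apply/increasingP => b b' bb'; rewrite !KPro_ffunE !KPro_fillE.
by have [_ /increasingP] := swaps_entry T; apply.
Qed.

Definition KPro_fun T : Inc q la := Sub (KPro_ffun T) (KPro_is_inc T).

Lemma KPro_inj : injective KPro_fun.
Proof.
move=> T T' /(congr1 val); rewrite !SubK => e.
apply: val_inj; apply/ffunP => b; apply: val_inj.
apply: (@swaps_inj la (iota 1 q.-1) (entry T) (entry T')) => x.
by rewrite -!KPro_fillE -!KPro_ffunE e.
Qed.

Definition KPro : {perm Inc q la} := perm KPro_inj.

Lemma KProE T b : entry (KPro T) b = KPro_fill q (entry T) b.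
Proof. by rewrite permE /entry SubK KPro_ffunE. Qed.

End KPro.

(* Main.v *)
Require Import Defs.
From mathcomp Require Import all_boot all_fingroup.
From mathcomp Require Import cyclic zify.

(** K-promotion is the composite of the involutions [swap 1], .., [swap q.-1]
    ([KPro_fillE]).  Each [swap k] exchanges the presence of the labels [k] and
    [k.+1] in an increasing filling ([occurs_swap]): on one-box components the
    two labels are literally exchanged, and a larger component, which is left
    alone, contains both labels, because adjacent boxes of an increasing filling
    carry different labels.  So the presence of the label 1 is carried up through
    the positions 2, .., q while every other one moves down by one, which is the
    cyclic shift of the binary content ([Con_KPro]).

    The shift acts nontrivially on the contents exactly when some content is not
    constant.  In an increasing filling the labels grow by at least the lattice
    distance between two comparable boxes ([increasing_gap]); hence a longest
    chain has at most q boxes, and when it has exactly q boxes its labels are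
    forced to be 1, .., q and the content is constantly true; without boxes the
    content is constantly false.  Conversely, when the diagram is nonempty and
    its longest chain is shorter than q, the filling of each box by its rank in
    the diagram uses the label 1 but not q, so that its content moves. *)

Set Implicit Arguments.
Unset Strict Implicit.
Unset Printing Implicit Defensive.

(** * Labels occurring in a filling *)

Definition occurs (la : int_partition) (v : box la -> nat) (j : nat) : bool :=
  [exists b, v b == j].

Lemma adjacent_neq (la : int_partition) (v : box la -> nat) b b' :
  increasing v -> adjacent b b' -> v b != v b'.
Proof.
move=> /increasingP vP; rewrite /adjacent.
have h1 := vP b b'; have h2 := vP b' b.
move=> H; suff: v b < v b' \/ v b' < v b by lia.
case/orP: H => /andP[/eqP e /orP[] /eqP l].
- by left; apply: h1; lia.
- by right; apply: h2; lia.
- by left; apply: h1; lia.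
- by right; apply: h2; lia.
Qed.

Lemma component_neighbour (la : int_partition) (A : pred (box la)) b :
  1 < #|component A b| -> exists2 b', A b' & adjacent b b'.
Proof.
move=> /card_gt1P [x [y [xb yb nxy]]].
have [z] : exists2 z, z \in component A b & z != b.
  by have [e|] := eqVneq x b; [exists y; rewrite // -e eq_sym | exists x].
rewrite inE => /connectP [[|w p] /= + ->]; first by rewrite eqxx.
by case/andP => /and3P [_ Aw bw] _ _; exists w.
Qed.

(** A component with several boxes, which [swap k] fixes, contains both labels;
    this is why it does not disturb the exchange. *)
Lemma big_component_labels (la : int_partition) k (v : box la -> nat) b :
  let A x := (v x == k) || (v x == k.+1) in
  increasing v -> A b -> 1 < #|component A b| ->
  occurs v (if v b == k then k.+1 else k).
Proof.
move=> A vinc Ab /component_neighbour [b' Ab' /(adjacent_neq vinc) nv].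
apply/existsP; exists b'.
by move: Ab Ab' nv; rewrite /A; case: eqP; lia.
Qed.

Lemma occurs_swap (la : int_partition) k (v : box la -> nat) j :
  increasing v ->
  occurs (swap k v) j =
  occurs v (if j == k then k.+1 else if j == k.+1 then k else j).
Proof.
(* [swap k] is an involution preserving increasing fillings, and so is the
   relabelling, so a single implication suffices. *)
pose s i := if i == k then k.+1 else if i == k.+1 then k else i.
have sK i : s (s i) = i.
  rewrite /s; case: (i =P k) => ?; last case: (i =P k.+1) => ?;
    by do ![case: eqP => ?]; lia.
have half w i : increasing w -> occurs (swap k w) i -> occurs w (s i).
  move=> winc /existsP [b /eqP <-].
  pose A x := (w x == k) || (w x == k.+1).
  have [Ab|nAb] := boolP (A b); last first.
    apply/existsP; exists b; move: nAb; rewrite /swap /s /A => /norP[n1 n2].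
    by rewrite (negbTE n1) (negbTE n2) /= (negbTE n1) (negbTE n2).
  have sw : s (w b) = if w b == k then k.+1 else k.
    by move: Ab; rewrite /s /A; do ![case: eqP => ?]; lia.
  rewrite /swap -/(A b) Ab /=; case: ifP => [_|/negbFE big].
    by rewrite -sw sK; apply/existsP; exists b.
  by rewrite sw; apply: big_component_labels.
move=> vinc; rewrite -/(s j); apply/idP/idP => [|/existsP [b vb]].
  exact: half.
rewrite -[j]sK; apply: half; first exact: swap_increasing.
by apply/existsP; exists b; rewrite swapK.
Qed.

Lemma occurs_swaps (la : int_partition) (v : box la -> nat) n j :
  increasing v -> 0 < j ->
  occurs (foldl (fun v k => swap k v) v (iota 1 n)) j =
  occurs v (if j <= n then j.+1 else if j == n.+1 then 1 else j).
Proof.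
elim: n j => [|n IHn] j vinc j_gt0.
  by rewrite /=; congr occurs; do ![case: ifP => ?]; lia.
have iotaSr : iota 1 n.+1 = rcons (iota 1 n) n.+1.
  by rewrite -[n.+1 in LHS]addn1 iotaD cats1 add1n.
have winc : increasing (foldl (fun v k => swap k v) v (iota 1 n)).
  by elim: (iota 1 n) v vinc {IHn} => //= k ks IH v /(swap_increasing k) /IH.
rewrite iotaSr foldl_rcons occurs_swap // IHn //; last first.
  by do ![case: ifP => ?]; lia.
by congr occurs; case: (j =P n.+1) => ?; last case: (j =P n.+2) => ?;
  do ![case: ifP => ?]; lia.
Qed.

(** * Equivariance of the binary content *)

Lemma nth_Con q la (T : Inc q la) i :
  i < q -> nth false (Con T) i = occurs (entry T) i.+1.
Proof.
by move=> iq; rewrite -[i]/(nat_of_ord (Ordinal iq)) -tnth_nth tnth_mktuple.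
Qed.

Lemma nth_cyc_shift q (a : q.-tuple bool) i : i < q ->
  nth false (cyc_shift q a) i = nth false a (if i.+1 < q then i.+1 else 0).
Proof.
move=> iq; rewrite permE /= /rot nth_cat size_drop size_tuple nth_drop add1n.
have -> : (i < q - 1) = (i.+1 < q) by lia.
by case: ifP => // ?; rewrite nth_take; [congr nth|]; lia.
Qed.

Lemma eq_word q (a b : q.-tuple bool) :
  (forall i, i < q -> nth false a i = nth false b i) -> a = b.
Proof.
move=> ab; apply: val_inj; apply: (@eq_from_nth _ false) => [|i].
  by rewrite !size_tuple.
by rewrite size_tuple; apply: ab.
Qed.

Lemma Con_KPro q la (T : Inc q la) : Con (KPro q la T) = cyc_shift q (Con T).
Proof.
apply: eq_word => i iq; rewrite nth_Con // nth_cyc_shift // nth_Con; last first.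
  by case: ifP => ?; lia.
have -> : occurs (entry (KPro q la T)) i.+1 =
    occurs (foldl (fun v k => swap k v) (entry T) (iota 1 q.-1)) i.+1.
  by apply: eq_existsb => b; rewrite KProE KPro_fillE.
rewrite occurs_swaps //; last exact: entry_increasing.
by congr occurs; do ![case: ifP => ?]; lia.
Qed.

Lemma cyc_shiftX q (a : q.-tuple bool) n :
  n <= q -> (cyc_shift q ^+ n)%g a = rot n a :> seq bool.
Proof.
elim: n => [|n IHn] nq; first by rewrite expg0 perm1 rot0.
rewrite expgSr permM permE /= IHn; last exact: ltnW.
by rewrite -rotS // size_tuple.
Qed.

Lemma order_cyc_shift q : 0 < q -> #[cyc_shift q]%g = q.
Proof.
move=> q_gt0.
have q_dvd : #[cyc_shift q]%g %| q.
  rewrite order_dvdn; apply/eqP/permP => a; apply: val_inj.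
  by rewrite /= cyc_shiftX // perm1 -{1}(size_tuple a) rot_size.
have := dvdn_leq q_gt0 q_dvd; rewrite leq_eqVlt => /orP[/eqP //|lt_q].
(* A word with a single letter true distinguishes the rotations. *)
have := congr1 (fun s : {perm q.-tuple bool} =>
  nth false (s [tuple val i == 0 | i < q]) 0) (expg_order (cyc_shift q)).
rewrite cyc_shiftX; last exact: ltnW.
set n := #[_]%g in lt_q *; have n_gt0 : 0 < n by exact: order_gt0.
have nthE i : i < q -> nth false [tuple val i == 0 | i < q] i = (i == 0).
  by move=> iq; rewrite -[i in LHS]/(nat_of_ord (Ordinal iq)) -tnth_nth tnth_mktuple.
rewrite perm1 nthE // /rot nth_cat size_drop size_tuple subn_gt0 lt_q.
by rewrite nth_drop addn0 nthE //; lia.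
Qed.

Lemma KPro_resonance_equivariance q la : 0 < q ->
  resonance_equivariance
    <[KPro q la]> (KPro q la) 'P <[cyc_shift q]> (cyc_shift q) 'P
    (contents q la) (@Con q la) q.
Proof.
move=> q_gt0; split; first by split=> //; exact: order_cyc_shift.
split=> [||T]; [|by []|]; last by rewrite /= !apermE Con_KPro.
rewrite cycle_subG !inE /=; apply/subsetP => _ /imsetP [T _ ->].
by rewrite inE /= apermE -Con_KPro; apply/imsetP; exists (KPro q la T).
Qed.

(** * Chains of boxes and the labels they force *)

(** Between two comparable boxes there is a lattice path inside the diagram: the
    induction walks back from [b'], first along its row, then up the column of
    [b], and the label drops at every step. *)
Lemma increasing_gap (la : int_partition) (v : box la -> nat) b b' :
  increasing v -> row b <= row b' -> col b <= col b' ->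
  v b + (row b' - row b) + (col b' - col b) <= v b'.
Proof.
move=> /increasingP vP.
have [n] := ubnP (row b' + col b').
elim: n b' => // n IHn b' lt_n ler lec.
have [lc|gc] := ltnP (col b) (col b').
  have [|x [xr xc]] := @box_ex la (row b') (col b').-1.
    by have := box_in b'; lia.
  by have := IHn x; have := vP x b'; rewrite xr xc; lia.
have [lr|gr] := ltnP (row b) (row b').
  have [|x [xr xc]] := @box_ex la (row b').-1 (col b').
    by apply: leq_trans (box_in b') _; apply: parts_leq; lia.
  by have := IHn x; have := vP x b'; rewrite xr xc; lia.
suff -> : b = b' by lia.
by apply: val_inj; apply: injective_projections; apply: val_inj;
  rewrite /= -/(row b) -/(row b') -/(col b) -/(col b'); lia.
Qed.

Lemma part_gt0 (la : int_partition) r : r < size la -> 0 < nth 0 la r.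
Proof.
move=> /(mem_nth 0) H; rewrite lt0n; apply: contraTneq H => ->.
by case: la => s /= /andP[].
Qed.

Lemma rank_lt_chain_length (la : int_partition) (b : box la) :
  row b + col b < chain_length la.
Proof.
apply: leq_trans (leq_bigmax (val b).1).
by rewrite -/(row b) ltn_add2l box_in.
Qed.

Lemma chain_length_attained (la : int_partition) : 0 < chain_length la ->
  exists2 r, r < size la & chain_length la = r + nth 0 la r.
Proof.
move=> chain_gt0; have size_gt0 : 0 < #|'I_(size la)|.
  rewrite card_ord lt0n; apply: contraTneq chain_gt0 => size0.
  rewrite -leqNgt; apply/bigmax_leqP => i _.
  by have := ltn_ord i; lia.
have [r e] := eq_bigmax (fun r : 'I_(size la) => r + nth 0 la r) size_gt0.
by exists r.
Qed.

(** A longest chain goes down the first column to some row and then along that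
    row to its end.  It squeezes the labels: at step [m] the label exceeds [m]
    because of the boxes before it, and leaves room up to [q] for the boxes
    after it. *)
Lemma chain_labels (la : int_partition) (v : box la -> nat) q m :
  increasing v -> (forall b, 0 < v b <= q) -> m < chain_length la ->
  exists b, m < v b /\ v b + chain_length la <= q + m.+1.
Proof.
move=> vinc vq lt_m.
have [|r r_lt e] := @chain_length_attained la; first by lia.
have lr_gt0 := part_gt0 r_lt; rewrite e in lt_m *.
have size_gt0 : 0 < size la by lia.
have [o [oR oC]] := box_ex (part_gt0 size_gt0).
have [|z [zR zC]] := @box_ex la r (nth 0 la r).-1; first by lia.
(* The box at step [m] of the chain; at most one of [r - m] and [m - r] is
   nonzero, so its distances to the two ends of the chain add up. *)
have [|b [bR bC]] := @box_ex la (minn m r) (m - r).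
  have [le_mr|lt_rm] := leqP m r; last by lia.
  have -> : m - r = 0 by lia.
  by apply: part_gt0; lia.
exists b; have := increasing_gap (b := o) (b' := b) vinc.
have := increasing_gap (b := b) (b' := z) vinc.
have := vq o; have := vq z.
by rewrite oR oC bR bC zR zC; lia.
Qed.

Lemma chain_length_leq q la (T : Inc q la) : chain_length la <= q.
Proof.
case: (posnP (chain_length la)) => [->//|chain_gt0].
have [|b []] := @chain_labels la (entry T) q (chain_length la).-1
  (entry_increasing T) (entry_bound T); lia.
Qed.

(** * Constant and nonconstant contents *)

Lemma Con_chain0 q la (T : Inc q la) i :
  chain_length la = 0 -> i < q -> nth false (Con T) i = false.
Proof.
move=> e iq; rewrite nth_Con //; apply/existsP => -[b _].
by have := rank_lt_chain_length b; rewrite e.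
Qed.

Lemma Con_chain_max q la (T : Inc q la) i :
  chain_length la = q -> i < q -> nth false (Con T) i = true.
Proof.
move=> e iq; rewrite nth_Con //; apply/existsP.
have [|b []] := @chain_labels la (entry T) q i (entry_increasing T)
  (entry_bound T); first by rewrite e.
by rewrite e => ? ?; exists b; lia.
Qed.

Lemma cyc_shift_const q (a : q.-tuple bool) x :
  (forall i, i < q -> nth false a i = x) -> cyc_shift q a = a.
Proof.
move=> ax; apply: eq_word => i iq; rewrite nth_cyc_shift // !ax //.
by case: ifP; lia.
Qed.

Section RankTableau.

Context (q : nat) (la : int_partition) (chain_lt : chain_length la < q).

Definition rank_ffun : {ffun box la -> 'I_q.+1} :=
  [ffun b => inord (row b + col b).+1].

Lemma rank_ffunE b : rank_ffun b = (row b + col b).+1 :> nat.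
Proof.
rewrite ffunE inordK //.
by have := rank_lt_chain_length b; lia.
Qed.

Lemma rank_is_inc : is_inc rank_ffun.
Proof.
apply/andP; split; first by apply/forallP => b; rewrite rank_ffunE.
by apply/increasingP => b b' bb'; rewrite !rank_ffunE; lia.
Qed.

(** The pointwise smallest increasing tableau; it leaves the label [q] free
    because every chain has fewer than [q] boxes. *)
Definition rank_tableau : Inc q la := Sub rank_ffun rank_is_inc.

Lemma entry_rank_tableau b : entry rank_tableau b = (row b + col b).+1.
Proof. by rewrite /entry SubK rank_ffunE. Qed.

Lemma Con_rank_tableau_moved :
  0 < chain_length la -> cyc_shift q (Con rank_tableau) != Con rank_tableau.
Proof.
move=> chain_gt0; have [r r_lt _] := chain_length_attained chain_gt0.
have size_gt0 : 0 < size la by lia.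
have [o [oR oC]] := box_ex (part_gt0 size_gt0).
(* The shift brings the occurrence of the label 1 to the last position. *)
apply/eqP => /(congr1 (fun a : q.-tuple bool => nth false a q.-1)).
rewrite nth_cyc_shift; last by lia.
have -> : (q.-1.+1 < q) = false by lia.
rewrite !nth_Con; try lia.
have -> : occurs (entry rank_tableau) 1.
  by apply/existsP; exists o; rewrite entry_rank_tableau oR oC.
move/esym/existsP => -[b /eqP]; rewrite entry_rank_tableau.
by have := rank_lt_chain_length b; lia.
Qed.

End RankTableau.

Lemma contents_acts_nontrivially q la :
  acts_nontrivially <[cyc_shift q]> 'P (contents q la) <->
  0 < chain_length la < q.
Proof.
split=> [[_ /cycleP [n ->]] [_ /imsetP [T _ ->]]|/andP[chain_gt0 chain_lt]].
  move=> moved.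
  have : cyc_shift q (Con T) <> Con T.
    move=> fixT; case/eqP: moved; rewrite /= apermE permX.
    exact: iter_fix.
  have := chain_length_leq T; have := @Con_chain0 q la T.
  have := @Con_chain_max q la T.
  case: (posnP (chain_length la)) => [e _ c0 _|_ c1 _ le_q] nfix.
    by case: nfix; apply: (@cyc_shift_const q _ false) => i; apply: c0.
  rewrite /= ltn_neqAle le_q andbT; apply/eqP => e; case: nfix.
  by apply: (@cyc_shift_const q _ true) => i; apply: c1.
exists (cyc_shift q); first exact: cycle_id.
exists (Con (rank_tableau chain_lt)); first exact: imset_f.
by rewrite /= apermE; apply: Con_rank_tableau_moved.
Qed.

Theorem theorem2p2 (la : int_partition) (q : nat) (hq : 0 < q) :
  resonance_equivariance
    <[KPro q la]> (KPro q la) 'P <[cyc_shift q]> (cyc_shift q) 'P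
    (contents q la) (@Con q la) q
  /\
  (exhibits_resonance
     <[KPro q la]> (KPro q la) 'P <[cyc_shift q]> (cyc_shift q) 'P
     (contents q la) (@Con q la) q
   <-> 0 < chain_length la < q).
Proof.
have equi := KPro_resonance_equivariance la hq; split=> //.
rewrite /exhibits_resonance contents_acts_nontrivially.
by split=> [[]|].
Qed.
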